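(* Let $n\ge 1$, $N=2n$. Let $\alpha$ and $\beta$ be independent random permutations of $[N]$, with $\alpha$ uniform on the set $\mathcal C_2$ of the $(N-1)!!$ fixed-point-free involutions of $[N]$ and $\beta$ uniform on the set $\mathcal C_N$ of the $(N-1)!$ $N$-cycles of $[N]$. Let $X_n$ be the number of cycles of $\gamma=\alpha\beta$. Then for every $\nu\in[1,N]$, \[ \mathrm P(X_n=\nu)=[x^Ny^{\nu}]\sum_{\lambda_1=1}^N(-1)^{\lambda^1}F(N,\lambda_1)\,[\xi^{\lambda_1}]\left[\frac{\xi}{1-\xi}\left(\frac{1-x}{1-x\xi}\right)^y\right], \] equivalently \[ \mathrm E[y^{X_n}]=\sum_{\lambda_1=1}^N(-1)^{\lambda^1}F(N,\lambda_1)\,[\xi^{\lambda_1}x^N]\left[\frac{\xi}{1-\xi}\left(\frac{1-x}{1-x\xi}\right)^y\right]. \]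
   Context: $[\cdot]$ denotes coefficient extraction in formal power series. For $1\le\lambda_1\le N$ set $\lambda^1=N+1-\lambda_1$. Define $F(N,\lambda_1)=(-1)^{(\lambda^1-1)/2}\binom{(N-2)/2}{(\lambda_1-2)/2}\big/\binom{N-1}{\lambda_1-1}$ if $\lambda_1$ is even, and $F(N,\lambda_1)=(-1)^{(\lambda^1+2)/2}\binom{(N-2)/2}{(\lambda_1-1)/2}\big/\binom{N-1}{\lambda_1-1}$ if $\lambda_1$ is odd. *)

(* Defs.v *)
From HB Require Import structures.
From mathcomp Require Import all_boot all_order all_algebra all_fingroup.
Set Implicit Arguments. Unset Strict Implicit. Unset Printing Implicit Defensive.
Import GRing.Theory Num.Theory.
Local Open Scope ring_scope.

Definition fpf_involutions (N : nat) : {set {perm 'I_N}} :=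
  [set s : {perm 'I_N} | [forall i, (s (s i) == i) && (s i != i)]].

Definition full_cycles (N : nat) : {set {perm 'I_N}} :=
  [set s : {perm 'I_N} | [forall i, #|porbit s i| == N]].

Definition ncycles (N : nat) (s : {perm 'I_N}) : nat := #|porbits s|.

Definition prob_ncycles (N nu : nat) : rat :=
  (#|[set p : {perm 'I_N} * {perm 'I_N} |
        [&& p.1 \in fpf_involutions N, p.2 \in full_cycles N &
            ncycles (p.1 * p.2) == nu]]|)%:R
  / (#|fpf_involutions N| * #|full_cycles N|)%:R.

(* F(N, lambda_1) ; lambda^1 = N + 1 - lambda_1 *)
Definition Fcoef (N l : nat) : rat :=
  if ~~ odd l then
    (-1) ^+ ((((N + 1 - l) - 1)./2)%N) * ('C((N - 2)./2, (l - 2)./2))%:R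
      / ('C(N - 1, l - 1))%:R
  else
    (-1) ^+ ((((N + 1 - l) + 2)./2)%N) * ('C((N - 2)./2, (l - 1)./2))%:R
      / ('C(N - 1, l - 1))%:R.

(* Power series in x (outer variable) with coefficients power series in xi
   (inner variable).  logq N is log((1-x)/(1-x xi)) = sum_{m>=1} (xi^m - 1) x^m / m,
   truncated at x-degree N (exact for all coefficients [x^k], k <= N). *)
Definition logq (N : nat) : {poly {poly rat}} :=
  \sum_(1 <= m < N.+1)
     (((m%:R : rat)^-1)%:P * ('X^m - 1))%:P * 'X^m.

(* xi/(1-xi) = sum_{k>=1} xi^k, truncated at degree N
   (exact for all coefficients [xi^k], k <= N). *)
Definition geoq (N : nat) : {poly rat} := \sum_(1 <= k < N.+1) 'X^k.

(* [x^N y^nu xi^l] ( xi/(1-xi) * ((1-x)/(1-x xi))^y ), where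
   f^y := exp(y log f), so [y^nu] f^y = (log f)^nu / nu!. *)
Definition gf_coef (N nu l : nat) : rat :=
  (geoq N * (logq N ^+ nu)`_N)`_l / (nu`!)%:R.

(* Main.v *)
Require Import Defs.
From HB Require Import structures.
From mathcomp Require Import all_boot all_order all_algebra all_fingroup.
From mathcomp Require Import ring zify.
Import GRing.Theory Num.Theory.
Local Open Scope ring_scope.
Set Implicit Arguments. Unset Strict Implicit. Unset Printing Implicit Defensive.

(** For a fixed permutation [a] of [N] points with cycle lengths [l_i], the sum
of [y ^ cycles(a b)] over the [N]-cycles [b] is [(N - 1)!] times the coefficient
of [z ^ (N + 1)] in [(1 - z) ^ (- y) * prod_i (1 - (1 - z) ^ l_i)].  This is
proved by induction on [N]: deleting a point from [b] expresses the sum for [a],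
obtained from [a'] by inserting the point before [t], through those for [a'] and
for the products [a' (c t)].  The product over the cycles is [det (1 - u P_a)]
at [u = 1 - z]; multiplying [a'] by a transposition is a rank one update of the
matrix, so the sum over [c] is read off the adjugate, whose trace is given by
Jacobi's formula.  For a fixed-point-free involution the determinant is
[(1 - u ^ 2) ^ n], and expanding [(1 + u) (1 - u ^ 2) ^ (n - 1)] gives the
coefficients [F(N, l)].  On the other side, the coefficient of [x ^ N xi ^ l] in
[xi / (1 - xi) * ((1 - x) / (1 - x xi)) ^ y] is the hook term
[(-1) ^ (N - l + 1) 'C(N - 1, l - 1) 'C(y + l - 1, N)], because both satisfy the
three-term recurrence that comes from the differential equation in [x]. *)

(** * Cycles and the insertion of a point *)

Section LiftedPermutations.

Variable n : nat.
Implicit Types (s t : 'S_n) (x y a b : 'I_n).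

Lemma lift0_permM s t : lift0_perm (s * t) = (lift0_perm s * lift0_perm t)%g.
Proof. by rewrite /lift0_perm -(lift_permM 0 0 0). Qed.

Lemma lift0_tperm a b :
  lift0_perm (tperm a b) = tperm (lift 0 a : 'I_n.+1) (lift 0 b).
Proof.
apply/permP => i; case: (unliftP 0 i) => [j|] ->; last first.
  by rewrite lift0_perm0 tpermD // eq_sym neq_lift.
by rewrite lift0_perm_lift (inj_tperm _ _ _ (@lift_inj _ _)).
Qed.

Lemma lift0_permX s k x :
  (lift0_perm s ^+ k)%g (lift 0 x) = lift (0 : 'I_n.+1) ((s ^+ k)%g x).
Proof. by rewrite !permX; elim: k => //= k ->; rewrite lift0_perm_lift. Qed.

Lemma porbit_lift0 s x :
  porbit (lift0_perm s) (lift 0 x) = lift (0 : 'I_n.+1) @: porbit s x.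
Proof.
apply/setP => y; apply/porbitP/imsetP => [[i ->]|[z /porbitP[i ->] ->]].
  by rewrite lift0_permX; exists ((s ^+ i)%g x) => //; apply: mem_porbit.
by exists i; rewrite lift0_permX.
Qed.

Lemma porbit_lift0_0 s : porbit (lift0_perm s) 0 = [set 0 : 'I_n.+1].
Proof.
apply/setP => y; rewrite inE; apply/porbitP/eqP => [[i ->]|->]; last first.
  by exists 0; rewrite expg0 perm1.
by rewrite permX; elim: i => //= i ->; rewrite lift0_perm0.
Qed.

Lemma porbits_lift0 s :
  porbits (lift0_perm s) =
    [set 0] |: [set lift (0 : 'I_n.+1) @: (c : {set 'I_n}) | c in porbits s].
Proof.
apply/setP => c; rewrite !inE; apply/imsetP/orP => [[y _ ->]|].
  case: (unliftP 0 y) => [j|] ->; last by left; rewrite porbit_lift0_0.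
  by right; apply/imsetP; exists (porbit s j); rewrite ?porbit_lift0 ?imset_f.
case=> [/eqP->|/imsetP[_ /imsetP[j _ ->] ->]].
  by exists 0; rewrite ?porbit_lift0_0.
by exists (lift 0 j); rewrite ?porbit_lift0.
Qed.

Lemma card_porbits_lift0 s : #|porbits (lift0_perm s)| = #|porbits s|.+1.
Proof.
rewrite porbits_lift0 cardsU1 card_imset; last exact/imset_inj/lift_inj.
case: imsetP => // [[c _ /setP/(_ 0)]]; rewrite inE eqxx => /esym/imsetP[j _].
by move/eqP; rewrite (negPf (neq_lift _ _)).
Qed.

(** In [lift0_perm s] the point 0 is a cycle by itself; the transposition merges it into the cycle
    of [b], so the extra cycle is lost. *)
Lemma card_porbits_tperm_lift0 b s :
  #|porbits (tperm 0 (lift 0 b) * lift0_perm s)| = #|porbits s|.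
Proof.
have := porbits_mul_tperm (lift0_perm s) 0 (lift 0 b).
rewrite neq_lift /= card_porbits_lift0 porbit_lift0.
case: imsetP => [[j _ /eqP]|_ /=]; first by rewrite (negPf (neq_lift _ _)).
by rewrite addn2 addn1 => -[].
Qed.

Lemma lift0_tpermC s x :
  (lift0_perm s * tperm 0 (lift 0 x) =
   tperm 0 (lift 0 (s^-1 x)%g) * lift0_perm s)%g.
Proof.
by rewrite [RHS]conjgC tpermJ lift0_perm0 lift0_perm_lift permKV.
Qed.

Lemma tperm_lift0_inj :
  injective (fun p : 'I_n.+1 * 'S_n => tperm 0 p.1 * lift0_perm p.2)%g.
Proof.
move=> [c s] [d t] /= eq_cs.
have def_c: c = d.
  have: (tperm 0 c * lift0_perm s)%g c = 0 by rewrite permM tpermR lift0_perm0.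
  rewrite eq_cs permM => /eqP; rewrite lift0_perm_eq0 => /eqP td.
  by rewrite -[c](tpermK 0 d) td tpermL.
move: eq_cs; rewrite def_c => /mulgI eq_st; congr (_, _).
apply/permP => x; have /permP/(_ (lift 0 x)) := eq_st.
by rewrite !lift0_perm_lift => /lift_inj.
Qed.

Lemma tperm_lift0_bij :
  bijective (fun p : 'I_n.+1 * 'S_n => tperm 0 p.1 * lift0_perm p.2)%g.
Proof.
apply: inj_card_bij tperm_lift0_inj _.
by rewrite card_prod !card_Sn card_ord.
Qed.

Lemma lift0_tperm_decomp (s : 'S_n.+1) :
  exists t c, s = (lift0_perm t * tperm 0 c)%g.
Proof.
have [f _ fK] := tperm_lift0_bij.
(* [f] splits off a transposition on the left; using it on the inverse moves the transposition to
   the right. *)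
exists (f s^-1).2^-1%g, (f s^-1).1%g.
rewrite -[LHS]invgK -[X in (X^-1)%g = _]fK /= invMg tpermV.
by rewrite /lift0_perm lift_permV.
Qed.

Lemma sum_perm_lift0 (V : nmodType) (F : 'S_n.+1 -> V) :
  \sum_s F s = \sum_(c : 'I_n.+1) \sum_(s : 'S_n) F (tperm 0 c * lift0_perm s)%g.
Proof.
rewrite pair_big /= (reindex _ (onW_bij _ tperm_lift0_bij)) /=.
by apply: eq_bigr => -[].
Qed.

End LiftedPermutations.

Lemma porbits_gt0 n (s : 'S_n.+1) : (0 < #|porbits s|)%N.
Proof. by apply/card_gt0P; exists (porbit s 0); apply: imset_f. Qed.

Lemma porbits_S1 (s : 'S_1) : #|porbits s| = 1%N.
Proof.
apply/eqP; rewrite eqn_leq porbits_gt0 andbT.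
by apply: leq_trans (leq_imset_card _ _) _; rewrite card_ord.
Qed.

(** A summand of [sum_perm_lift0] with [c = 0] fixes 0 and has at least two cycles; every other [c]
    inserts 0 into a cycle and keeps the number of cycles. *)
Lemma sum_full_cycles_lift0 (V : nmodType) n (F : 'S_n.+2 -> V) :
  \sum_(s : 'S_n.+2 | #|porbits s| == 1%N) F s =
  \sum_(a : 'I_n.+1) \sum_(s : 'S_n.+1 | #|porbits s| == 1%N)
     F (tperm 0 (lift 0 a) * lift0_perm s)%g.
Proof.
rewrite big_mkcond sum_perm_lift0 big_ord_recl big1 => [|s _]; last first.
  by rewrite tperm1 mul1g card_porbits_lift0 eqSS; case: #|_| (porbits_gt0 s).
rewrite add0r; apply: eq_bigr => a _; rewrite [RHS]big_mkcond.
by apply: eq_bigr => s _; rewrite card_porbits_tperm_lift0.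
Qed.

Lemma card_single_porbit n :
  #|[set s : 'S_n.+1 | #|porbits s| == 1%N]| = n`!.
Proof.
rewrite -sum1_card.
rewrite (eq_bigl (fun s : 'S_n.+1 => #|porbits s| == 1%N)) => [|s].
  2: by rewrite inE.
elim: n => [|n IHn]; last first.
  by rewrite sum_full_cycles_lift0 IHn sum_nat_const card_ord.
rewrite (big_pred1 1%g) // => s; rewrite porbits_S1.
by apply/esym/eqP/permP => i; rewrite !ord1.
Qed.

(* The variable of this polynomial is the [y] of the generating function. *)
Definition cycle_enum n (a : 'S_n) : {poly rat} :=
  \sum_(b : 'S_n | #|porbits b| == 1%N) 'X^#|porbits (a * b)%g|.

Lemma cycle_enum_lift0 n (a : 'S_n.+1) :
  cycle_enum (lift0_perm a) = n.+1%:R * cycle_enum a.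
Proof.
rewrite /cycle_enum sum_full_cycles_lift0 mulr_natl.
under eq_bigr => c _.
  under eq_bigr => s _.
    rewrite mulgA lift0_tpermC -mulgA -lift0_permM card_porbits_tperm_lift0.
    over.
  over.
by rewrite sumr_const card_ord.
Qed.

Lemma tperm0_mul_tperm0 n (a b : 'I_n) : a != b ->
  (tperm 0 (lift 0 b) * tperm (0 : 'I_n.+1) (lift 0 a) =
   lift0_perm (tperm a b) * tperm 0 (lift 0 b))%g.
Proof.
move=> neq_ab; rewrite lift0_tperm [RHS]conjgC tpermJ tpermR tpermC.
rewrite tpermD 1?[tperm (lift 0 a) _]tpermC ?neq_lift //.
by rewrite (inj_eq (@lift_inj _ _)) eq_sym.
Qed.

(** If the full cycle has 0 inserted at [b], the two transpositions cancel and 0 becomes a separate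
    cycle, whence ['X]; at [c != b] they turn [a] into [a * tperm c b]. The sum on the right also
    contains [c = b], whence the [- 1]. *)
Lemma cycle_enum_tperm n (a : 'S_n.+1) b :
  cycle_enum (lift0_perm a * tperm 0 (lift 0 b))%g =
  ('X - 1) * cycle_enum a + \sum_c cycle_enum (a * tperm c b)%g.
Proof.
rewrite {1}/cycle_enum sum_full_cycles_lift0 (bigD1 b) //= [in RHS](bigD1 b) //=.
rewrite tperm1 mulg1 addrA; congr (_ + _).
  rewrite mulrBl mul1r subrK /cycle_enum mulr_sumr; apply: eq_bigr => s _.
  rewrite -mulgA (mulgA (tperm _ _)) tperm2 mul1g -lift0_permM.
  by rewrite card_porbits_lift0 exprS.
apply: eq_bigr => c neq_cb; apply: eq_bigr => s _.
rewrite -mulgA (mulgA (tperm _ _)) tperm0_mul_tperm0 // -mulgA mulgA -lift0_permM.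
by rewrite mulgA lift0_tpermC -mulgA -lift0_permM card_porbits_tperm_lift0.
Qed.

(** * Determinants of permutation pencils *)

(** The matrix determinant lemma, with [X] in the role of the adjugate, so that no inverse is taken.
    The determinant of the bordered matrix [B] is computed in two ways. *)
Lemma det_add_rank1 (R : idomainType) n (A X : 'M[R]_n) (w : 'cV_n) (v : 'rV_n) :
    X *m A = (\det A)%:M -> \det A != 0 ->
  \det (A + w *m v) = \det A + (v *m X *m w) 0 0.
Proof.
move=> XA nz_d; set d := \det A in XA nz_d *.
pose B : 'M_(1 + n) := block_mx 1%:M (- v) w A.
have detB: \det B = \det (A + w *m v).
  have ->: B = block_mx 1%:M 0 w 1%:M *m block_mx 1%:M (- v) 0 (A + w *m v).
    rewrite mulmx_block !mul1mx !mulmx1 ?mul0mx ?mulmx0 !addr0 mulmxN.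
    by rewrite addrC addrK.
  by rewrite det_mulmx det_lblock det_ublock !det1 !mul1r.
apply: (mulfI nz_d); rewrite -detB.
(* This left factor is chosen so that its product with [B] has upper right block zero, by [XA]. *)
have detC: \det (block_mx d%:M (v *m X) 0 1%:M : 'M_(1 + n)) = d.
  by rewrite det_ublock det1 mulr1 det_scalar1.
rewrite -{1}detC -det_mulmx mulmx_block !mul1mx !mulmx1 ?mul0mx ?add0r.
rewrite -(mulmxA v X A) XA mul_mx_scalar mul_scalar_mx scalerN addNr.
by rewrite det_lblock mulrC -/d [X in _ * \det X]mx11_scalar det_scalar1 !mxE eqxx.
Qed.

Lemma deriv_prod (R : comNzRingType) (I : eqType) (r : seq I) (F : I -> {poly R}) :
  uniq r ->
  (\prod_(i <- r) F i)^`() =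
  \sum_(i <- r) (F i)^`() * \prod_(j <- r | j != i) F j.
Proof.
elim: r => [|x r IHr] /=; first by rewrite !big_nil derivC.
case/andP=> x_notin_r uniq_r; rewrite !big_cons derivM eqxx /= {}IHr //.
congr (_ * _ + _).
  rewrite big_seq [RHS]big_seq_cond; apply: eq_bigl => i.
  by case: eqP => [->|_]; rewrite ?(negPf x_notin_r) ?andbT.
rewrite mulr_sumr; apply: eq_big_seq => i r_i; rewrite big_cons.
have ->: x != i by apply: contraNneq x_notin_r => ->.
by rewrite mulrCA.
Qed.

Lemma deriv_det (R : comNzRingType) n (A : 'M[{poly R}]_n) :
  (\det A)^`() = \tr (\adj A *m map_mx (@deriv R) A).
Proof.
(* Only row [i] is differentiated, so expanding [B i] along that row produces cofactors of [A]
   itself. *)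
pose B i : 'M_n := \matrix_(j, k) if j == i then (A j k)^`() else A j k.
transitivity (\sum_i \det (B i)).
  transitivity (\sum_(s : 'S_n) \sum_i (-1) ^+ s * \prod_j B i j (s j)).
    2: by rewrite exchange_big.
  rewrite /determinant (big_morph _ (@derivD R) (derivC 0)); apply: eq_bigr => s _.
  rewrite -mulr_sumr; set e := odd_perm _.
  have -> : ((-1) ^+ e : {poly R}) = ((-1) ^+ e)%:P by rewrite rmorph_sign.
  rewrite mul_polyC derivZ -mul_polyC; congr (_ * _).
  rewrite deriv_prod ?index_enum_uniq //; apply: eq_bigr => i _.
  rewrite [RHS](bigD1 i) //= mxE eqxx; congr (_ * _).
  by apply: eq_bigr => j /negPf ji; rewrite mxE ji.
transitivity (\sum_i \sum_j cofactor A i j * (A i j)^`()); last first.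
  rewrite exchange_big; apply: eq_bigr => j _; rewrite mxE.
  by apply: eq_bigr => i _; rewrite !mxE.
apply: eq_bigr => i _; rewrite (expand_det_row _ i).
apply: eq_bigr => j _; rewrite mxE eqxx mulrC; congr (_ * _).
rewrite /cofactor; congr (_ * \det _); apply/matrixP => k l.
by rewrite !mxE eq_sym (negPf (neq_lift _ _)).
Qed.

Definition perm_char_mx n (s : 'S_n) : 'M[{poly rat}]_n :=
  1%:M - 'X *: perm_mx s.

(* The product of [1 - 'X ^+ l] over the lengths [l] of the cycles of [s]. *)
Definition perm_char_poly n (s : 'S_n) : {poly rat} := \det (perm_char_mx s).

Lemma perm_char_poly0 n (s : 'S_n) : (perm_char_poly s).[0] = 1.
Proof.
rewrite -horner_evalE -det_map_mx -[RHS](det1 _ n); congr (\det _).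
apply/matrixP => i j; rewrite !mxE /= horner_evalE !hornerE.
by case: (i == j); rewrite ?hornerE.
Qed.

Lemma perm_char_poly_neq0 n (s : 'S_n) : perm_char_poly s != 0.
Proof.
apply: contraTneq (oner_neq0 rat) => p0.
by rewrite -(perm_char_poly0 s) p0 horner0 eqxx.
Qed.

Lemma perm_mx_tperm (R : comNzRingType) n (a b : 'I_n)
    (v : 'rV[R]_n := delta_mx 0 a - delta_mx 0 b) :
  perm_mx (tperm a b) = 1%:M - v^T *m v :> 'M[R]_n.
Proof.
apply/matrixP => i j; rewrite !mxE big_ord1 !mxE eqxx !andTb.
rewrite !(eq_sym j); case: tpermP => [->|->|/eqP/negPf ia /eqP/negPf ib].
- by rewrite eqxx; case: (eqVneq a b) => [->|_] /=; ring.
- by rewrite eqxx; case: (eqVneq b a) => [->|_] /=; ring.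
- by rewrite ia ib /=; ring.
Qed.

(** A transposition is the identity minus a rank one matrix, so the pencil changes by [w *m v].
    Since ['X *: perm_mx s] is the identity minus the pencil, [X *m w] reduces to [K *m v^T], and
    the increment is the quadratic form of [K] at [v]. *)
Lemma perm_char_poly_tperm n (s : 'S_n) (X : 'M_n) a b
    (K := X - (perm_char_poly s)%:M) :
    X *m perm_char_mx s = (perm_char_poly s)%:M ->
  perm_char_poly (s * tperm a b)%g =
    perm_char_poly s + (K a a + K b b - K a b - K b a).
Proof.
move=> XM; pose v : 'rV[{poly rat}]_n := delta_mx 0 a - delta_mx 0 b.
pose w := 'X *: perm_mx s *m v^T.
have ->: perm_char_poly (s * tperm a b)%g = \det (perm_char_mx s + w *m v).
  congr (\det _); rewrite /perm_char_mx perm_mxM perm_mx_tperm -/v.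
  by rewrite mulmxBr mulmx1 scalerBr opprB addrCA addrC /w !scalemxAl mulmxA.
rewrite (det_add_rank1 _ _ XM) ?perm_char_poly_neq0 //; congr (_ + _).
have Xw: X *m w = K *m v^T.
  have ->: w = v^T - perm_char_mx s *m v^T.
    by rewrite /w /perm_char_mx mulmxBl mul1mx opprB addrCA subrr addr0.
  by rewrite mulmxBr mulmxA XM -mulmxBl.
rewrite -mulmxA Xw /v linearB /= !trmx_delta mulmxBl !mulmxBr -!rowE -!colE.
by rewrite !mxE; ring.
Qed.

Lemma perm_char_mx_lift0 n (s : 'S_n) :
  perm_char_mx (lift0_perm s) =
    block_mx (1 - 'X)%:M 0 0 (perm_char_mx s) :> 'M_(1 + n).
Proof.
apply/matrixP => i j; rewrite !mxE split1.
case: (unliftP 0 i) => [i'|] ->; rewrite /= !mxE split1.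
  rewrite lift0_perm_lift; case: (unliftP 0 j) => [j'|] ->.
    by rewrite /= !mxE !(inj_eq (@lift_inj _ _)).
  by rewrite /= !mxE mulr0 subr0.
rewrite lift0_perm0; case: (unliftP 0 j) => [j'|] ->.
  by rewrite /= !mxE mulr0 subr0.
by rewrite /= !mxE !eqxx mulr1.
Qed.

Lemma perm_char_poly_lift0 n (s : 'S_n) :
  perm_char_poly (lift0_perm s) = (1 - 'X) * perm_char_poly s.
Proof.
transitivity (\det (block_mx (1 - 'X)%:M 0 0 (perm_char_mx s) : 'M_(1 + n))).
  by congr (\det _); apply: perm_char_mx_lift0.
by rewrite det_ublock det_scalar1.
Qed.

Lemma perm_char_poly_lift0_tperm n (s : 'S_n) b :
  perm_char_poly (lift0_perm s * tperm 0 (lift 0 b))%g =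
  'X * perm_char_poly s + (1 - 'X) * (\adj (perm_char_mx s)) b b.
Proof.
(* The adjugate of the block diagonal pencil of [lift0_perm s], given blockwise so that its entries
   can be read off. *)
pose X : 'M_(1 + n) :=
  block_mx (perm_char_poly s)%:M 0 0 ((1 - 'X) *: \adj (perm_char_mx s)).
have XM: X *m perm_char_mx (lift0_perm s) = (perm_char_poly (lift0_perm s))%:M.
  transitivity (X *m (block_mx (1 - 'X)%:M 0 0 (perm_char_mx s) : 'M_(1 + n))).
    by congr (_ *m _); apply: perm_char_mx_lift0.
  rewrite /X mulmx_block !mulmx0 !mul0mx !addr0 !add0r -scalemxAl mul_adj_mx.
  rewrite scale_scalar_mx -scalar_mxM mulrC perm_char_poly_lift0.
  by rewrite -(scalar_mx_block 1 n).
rewrite (perm_char_poly_tperm _ _ XM).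
rewrite perm_char_poly_lift0 !mxE !split1 !unlift_none !liftK /= !mxE !split1.
rewrite !unlift_none !liftK /= !mxE /= !eqxx !mulr1n !mulr0n.
by ring.
Qed.

(** The all-ones row is a left eigenvector of the pencil with eigenvalue [1 - 'X]; multiplying by
    the adjugate gives its column sums. *)
Lemma sum_adj_perm_char_row n (s : 'S_n) b :
  (1 - 'X) * (\sum_a (\adj (perm_char_mx s)) a b) = perm_char_poly s.
Proof.
pose e : 'rV[{poly rat}]_n := const_mx 1.
have eM: e *m perm_char_mx s = (1 - 'X) *: e.
  rewrite /perm_char_mx mulmxBr mulmx1 scalerBl scale1r -scalemxAr; congr (_ - _ *: _).
  apply/rowP => j; rewrite !mxE (bigD1 (s^-1 j)%g) //= !mxE permKV eqxx mulr1.
  rewrite big1 ?addr0 // => i; rewrite !mxE => ne.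
  rewrite (can2_eq (permK s) (permKV s)).
  by rewrite (negPf ne) mulr0.
have /(congr1 (fun A : 'rV_n => A 0 b)) :
    (1 - 'X) *: (e *m \adj (perm_char_mx s)) = perm_char_poly s *: e.
  by rewrite scalemxAl -eM -mulmxA mul_mx_adj mul_mx_scalar.
rewrite !mxE mulr1 => <-; congr (_ * _).
by apply: eq_bigr => i _; rewrite !mxE mul1r.
Qed.

Lemma sum_adj_perm_char_col n (s : 'S_n) a :
  (1 - 'X) * (\sum_b (\adj (perm_char_mx s)) a b) = perm_char_poly s.
Proof.
pose e : 'cV[{poly rat}]_n := const_mx 1.
have eM: perm_char_mx s *m e = (1 - 'X) *: e.
  rewrite /perm_char_mx mulmxBl mul1mx scalerBl scale1r -scalemxAl; congr (_ - _ *: _).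
  by rewrite -row_permE; apply/colP => j; rewrite !mxE.
have /(congr1 (fun A : 'cV_n => A a 0)) :
    (1 - 'X) *: (\adj (perm_char_mx s) *m e) = perm_char_poly s *: e.
  by rewrite scalemxAr -eM mulmxA mul_adj_mx mul_scalar_mx.
rewrite !mxE mulr1 => <-; congr (_ * _).
by apply: eq_bigr => i _; rewrite !mxE mulr1.
Qed.

Lemma deriv_perm_char_poly n (s : 'S_n) :
  (perm_char_poly s)^`() = - \tr (\adj (perm_char_mx s) *m perm_mx s).
Proof.
rewrite deriv_det -raddfN /= -mulmxN; congr (\tr (_ *m _)).
apply/matrixP => i j; rewrite !mxE derivB derivM derivX mul1r.
by case: (i == j); case: (s i == j); rewrite ?derivC ?mulr0 ?addr0 ?sub0r.
Qed.

Lemma tr_adj_perm_char n (s : 'S_n) :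
  \tr (\adj (perm_char_mx s)) =
  n%:R * perm_char_poly s - 'X * (perm_char_poly s)^`().
Proof.
rewrite deriv_perm_char_poly mulrN opprK -mxtraceZ scalemxAr.
have ->: 'X *: perm_mx s = 1%:M - perm_char_mx s by rewrite opprB addrC subrK.
rewrite mulmxBr mulmx1 mul_adj_mx raddfB /= mxtrace_scalar.
by rewrite -/(perm_char_poly s); ring.
Qed.

(** Summed over [c], [perm_char_poly_tperm] involves only the trace, one diagonal entry, one row sum
    and one column sum of the adjugate; the factor [1 - 'X] turns each of the last two into [A]. *)
Lemma sum_perm_char_poly_tperm n (s : 'S_n) b (A := perm_char_poly s) :
  (1 - 'X) * (\sum_c perm_char_poly (s * tperm c b)%g) =
  (1 - 'X) * (n%:R * (\adj (perm_char_mx s)) b b - 'X * A^`() + 2 * A) - 2 * A.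
Proof.
pose D := \adj (perm_char_mx s).
have -> : \sum_c perm_char_poly (s * tperm c b)%g =
    \tr D + n%:R * D b b - n%:R * A + 2 * A - \sum_c D c b - \sum_c D b c.
  transitivity (\sum_c (D c c + (D b b - A) + A *+ ((c == b) * 2) - D c b - D b c)).
    apply: eq_bigr => c _; rewrite (perm_char_poly_tperm _ _ (mul_adj_mx _)).
    rewrite -/D -/A -/(perm_char_poly s) -/A !mxE !eqxx (eq_sym b c).
    by case: (c == b); rewrite /= ?mulr1n ?mulr0n; ring.
  have sum_b : \sum_c A *+ ((c == b) * 2) = A *+ 2.
    by rewrite (bigD1 b) //= eqxx big1 ?addr0 // => c /negPf->.
  by rewrite !sumrB !big_split /= sum_b !sumr_const card_ord /mxtrace; ring.
rewrite tr_adj_perm_char -/A -/D mulrBr mulrBr sum_adj_perm_char_row.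
by rewrite sum_adj_perm_char_col -/A; ring.
Qed.

(** * Binomial polynomials and the cycle enumerator *)

Definition poly_bin (p : {poly rat}) m : {poly rat} :=
  (m`!%:R)^-1 *: \prod_(i < m) (p - i%:R).

Lemma natr_polyI m : injective (fun p : {poly rat} => m.+1%:R * p).
Proof. by apply: mulfI; rewrite -polyC_natr polyC_eq0 pnatr_eq0. Qed.

Lemma poly_bin1 p : poly_bin p 1 = p.
Proof. by rewrite /poly_bin big_ord1 invr1 scale1r subr0. Qed.

Lemma fact_poly_bin p m : m`!%:R * poly_bin p m = \prod_(i < m) (p - i%:R).
Proof.
rewrite /poly_bin -polyC_natr mul_polyC scalerA divff ?scale1r //.
by rewrite pnatr_eq0 -lt0n fact_gt0.
Qed.

Lemma fact_polyI m : injective (fun p : {poly rat} => m`!%:R * p).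
Proof. by rewrite -(prednK (fact_gt0 m)); apply: natr_polyI. Qed.

Lemma poly_binS p m :
  m.+1%:R * poly_bin p m.+1 = (p - m%:R) * poly_bin p m.
Proof.
apply: (@fact_polyI m); rewrite mulrA -natrM mulnC -factS fact_poly_bin.
by rewrite mulrCA fact_poly_bin big_ord_recr mulrC.
Qed.

Lemma poly_bin_absorb p m :
  m.+1%:R * poly_bin (p + 1) m.+1 = (p + 1) * poly_bin p m.
Proof.
apply: (@fact_polyI m); rewrite mulrA -natrM mulnC -factS fact_poly_bin.
rewrite mulrCA fact_poly_bin big_ord_recl subr0; congr (_ * _).
by apply: eq_bigr => i _; rewrite lift0; ring.
Qed.

Lemma poly_bin_pascal p m :
  poly_bin (p + 1) m.+1 = poly_bin p m.+1 + poly_bin p m.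
Proof.
apply: (@natr_polyI m); rewrite poly_bin_absorb mulrDr poly_binS.
by rewrite -natr1; ring.
Qed.

(* [shift_coef m q] is the coefficient of [z ^ m] in [(1 - z) ^ (- y) * q.[1 - z]],
   as a polynomial in [y]. *)
Definition shift_coef m (q : {poly rat}) : {poly rat} :=
  \sum_(k < size q) q`_k *: poly_bin ('X + m%:R - 1 - k%:R) m.

Lemma shift_coef_wide m d (q : {poly rat}) : (size q <= d)%N ->
  shift_coef m q = \sum_(k < d) q`_k *: poly_bin ('X + m%:R - 1 - k%:R) m.
Proof.
move=> le_qd; rewrite /shift_coef (big_ord_widen _ (fun k =>
  q`_k *: poly_bin ('X + m%:R - 1 - k%:R) m) le_qd) big_mkcond.
apply: eq_bigr => i _; case: ltnP => // le_qi.
by rewrite nth_default ?scale0r.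
Qed.

Lemma shift_coef_is_linear m : linear (shift_coef m).
Proof.
move=> c p q; pose d := maxn (size p) (size q).
have le_pd: (size p <= d)%N by apply: leq_maxl.
have le_qd: (size q <= d)%N by apply: leq_maxr.
have le_pqd: (size (c *: p + q)%R <= d)%N.
  rewrite (leq_trans (size_polyD _ _)) // geq_max le_qd andbT.
  exact: leq_trans (size_scale_leq _ _) _.
rewrite !(@shift_coef_wide m d) // scaler_sumr -big_split /=.
by apply: eq_bigr => i _; rewrite coefD coefZ scalerDl scalerA.
Qed.

HB.instance Definition _ m := GRing.isLinear.Build rat {poly rat} {poly rat} _
  (shift_coef m) (shift_coef_is_linear m).

Lemma shift_coefXn m k :
  shift_coef m 'X^k = poly_bin ('X + m%:R - 1 - k%:R) m.
Proof.
rewrite /shift_coef size_polyXn big_ord_recr big1 /= => [|i _].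
  by rewrite coefXn eqxx scale1r add0r.
by rewrite coefXn ltn_eqF // scale0r.
Qed.

Lemma poly_linear_ind (R : nzRingType) (P : {poly R} -> Prop) :
    P 0 -> (forall c p q, P p -> P q -> P (c *: p + q)) ->
  (forall k, P 'X^k) -> forall q, P q.
Proof.
move=> P0 PD PX q; rewrite -[q]coefK poly_def.
by elim/big_rec: _ => // i p _ Pp; apply: PD.
Qed.

(** At [1 - z] the factor [1 - 'X] becomes [z] and shifts the coefficient by one; on monomials this
    is Pascal's rule. *)
Lemma shift_coefM1X m q : shift_coef m.+1 ((1 - 'X) * q) = shift_coef m q.
Proof.
elim/poly_linear_ind: q => [|c p q IHp IHq|k]; first by rewrite mulr0 !linear0.
  by rewrite mulrDr -scalerAr !linearP /= IHp IHq.
rewrite mulrBl mul1r -exprS linearB /= !shift_coefXn.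
have -> : 'X + m.+1%:R - 1 - k%:R = 'X + m%:R - 1 - k%:R + 1 :> {poly rat}.
  by rewrite -natr1; ring.
have -> : 'X + m.+1%:R - 1 - k.+1%:R = 'X + m%:R - 1 - k%:R :> {poly rat}.
  by rewrite -!natr1; ring.
by rewrite poly_bin_pascal; ring.
Qed.

(** This compares coefficients of [z ^ m] in the [z]-derivative of [(1 - z) ^ (1 - y) *
    q.[1 - z]]. *)
Lemma shift_coefMX m q :
  m.+1%:R * shift_coef m.+1 ('X * q) =
  ('X - 1) * shift_coef m q - shift_coef m ('X * q^`()).
Proof.
elim/poly_linear_ind: q => [|c p q IHp IHq|k].
- by rewrite deriv0 !mulr0 !linear0 !mulr0 addr0.
- rewrite derivD derivZ !mulrDr -!scalerAr !linearP /= !mulrDr -!scalerAr IHp IHq.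
  by rewrite scalerBr; ring.
rewrite derivXn; case: k => [|k].
- rewrite mulr0n mulr0 linear0 subr0 expr0 mulr1 -['X]expr1 -(expr0 'X) !shift_coefXn.
  rewrite poly_binS expr1.
  have -> : 'X + m.+1%:R - 1 - 1%:R = 'X + m%:R - 1 - 0%:R :> {poly rat}.
    by rewrite -natr1; ring.
  by ring.
rewrite -pred_Sn mulrnAr -!exprS linearMn /= !shift_coefXn poly_binS.
have -> : 'X + m.+1%:R - 1 - k.+2%:R = 'X + m%:R - 1 - k.+1%:R :> {poly rat}.
  by rewrite -(natr1 m) -(natr1 k.+1); ring.
by rewrite -mulr_natl; ring.
Qed.

Theorem cycle_enumE n (a : 'S_n.+1) :
  cycle_enum a = n`!%:R * shift_coef n.+2 (perm_char_poly a).
Proof.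
elim: n a => [|n IHn] a.
  have [t [c ->]] := lift0_tperm_decomp a.
  rewrite (ord1 c) tperm1 mulg1 perm_char_poly_lift0 shift_coefM1X.
  rewrite /perm_char_poly det_mx00 -(expr0 'X) shift_coefXn mul1r.
  rewrite poly_bin1 /cycle_enum.
  under eq_bigl do rewrite porbits_S1.
  rewrite (big_pred1 1%g) => [|s]; last by apply/esym/eqP/permP=> i; rewrite !ord1.
  by rewrite porbits_S1; ring.
have [t [c ->]] := lift0_tperm_decomp a.
case: (unliftP 0 c) => [b|] ->; last first.
  rewrite tperm1 mulg1 perm_char_poly_lift0 shift_coefM1X cycle_enum_lift0 IHn.
  by rewrite factS natrM mulrA.
rewrite cycle_enum_tperm IHn; under eq_bigr => d _ do rewrite IHn.
rewrite -mulr_sumr -linear_sum /= mulrCA -mulrDr factS natrM mulrAC mulrC.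
congr (_ * _).
set A := perm_char_poly t; set S := \sum_d _.
pose B := perm_char_poly (lift0_perm t * tperm 0 (lift 0 b))%g.
(* The adjugate entry is eliminated in favour of [B]. The coefficient [n.+3%:R] is the one that
   [shift_coefMX] needs to cancel the term with ['X - 1]. *)
have defS: (1 - 'X) * S =
    n.+1%:R *: B - n.+3%:R *: ('X * A) - (1 - 'X) * ('X * A^`()).
  rewrite /S sum_perm_char_poly_tperm -/A /B perm_char_poly_lift0_tperm -/A.
  by rewrite -!mul_polyC !polyC_natr -(natr1 n.+2) -(natr1 n.+1) /=; ring.
rewrite -(shift_coefM1X n.+2 S) defS !linearB !linearZ /= shift_coefM1X.
by rewrite -!mul_polyC !polyC_natr mulrN shift_coefMX -/B; ring.
Qed.

(** * Fixed-point-free involutions *)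

(** Comparing coefficients determines each from earlier ones. Applied to a difference of two
    solutions, this is uniqueness for given constant term. *)
Lemma deriv_ode_eq0 (c : rat) (r : {poly rat}) :
  (1 - 'X^2) * r^`() = c *: ('X * r) -> r`_0 = 0 -> r = 0.
Proof.
move=> ode r0; apply/polyP => k; rewrite coef0.
have rec j : r`_j.+1 *+ j.+1 = (if (j < 2)%N then 0 else r`_(j - 2).+1 *+ (j - 2).+1) +
    c * (if j == 0%N then 0 else r`_j.-1).
  have /(congr1 (fun p : {poly rat} => p`_j)) := ode.
  rewrite mulrBl mul1r coefB coefXnM !coef_deriv coefZ coefXM => <-.
  by rewrite addrC subrK.
elim/ltn_ind: k => -[|k] IH //.
have /eqP: r`_k.+1 *+ k.+1 = 0; last by rewrite mulrn_eq0 => /eqP.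
rewrite rec; case: k IH => [|[|k]] IH /=; rewrite ?r0 ?mulr0 ?addr0 //.
by rewrite subSS subSS subn0 !IH ?mul0rn ?mulr0 ?addr0.
Qed.

(** As [P] squares to the identity, [1%:M + 'X *: P] inverts the pencil up to [1 - 'X^2], which
    yields the adjugate; as [P] has trace zero, Jacobi's formula becomes a differential equation. *)
Lemma perm_char_poly_fpf N (a : 'S_N) : a \in fpf_involutions N ->
  (1 - 'X^2) * (perm_char_poly a)^`() = (- N%:R) *: ('X * perm_char_poly a).
Proof.
rewrite inE => /forallP a_fpf.
have aa: (a * a = 1)%g.
  by apply/permP => i; rewrite permM perm1; have /andP[/eqP] := a_fpf i.
pose P : 'M[{poly rat}]_N := perm_mx a.
have PP: P *m P = 1%:M by rewrite -perm_mxM aa perm_mx1.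
have trP: \tr P = 0.
  by rewrite /mxtrace big1 // => i _; rewrite !mxE; have /andP[_ /negPf->] := a_fpf i.
have MP: perm_char_mx a *m (1%:M + 'X *: P) = (1 - 'X^2)%:M.
  rewrite /perm_char_mx -/P mulmxBl mul1mx mulmxDr mulmx1 -scalemxAl -scalemxAr PP.
  rewrite scalerA -expr2 opprD addrA addrK raddfB /=.
  by rewrite scale_scalar_mx mulr1.
have adjP: (1 - 'X^2) *: (\adj (perm_char_mx a) *m P) = perm_char_poly a *: (P + 'X%:M).
  rewrite -mul_mx_scalar -mulmxA scalar_mxC mulmxA -MP mulmxA mul_adj_mx.
  rewrite -mulmxA mulmxDl mul1mx -scalemxAl PP mul_scalar_mx.
  by rewrite scale_scalar_mx mulr1.
rewrite deriv_perm_char_poly -/P mulrN -mxtraceZ adjP mxtraceZ mxtraceD trP add0r.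
by rewrite mxtrace_scalar -mul_polyC polyCN polyC_natr; ring.
Qed.

Lemma perm_char_poly_fpfE n (a : 'S_(n.*2)) : a \in fpf_involutions n.*2 ->
  perm_char_poly a = (1 - 'X^2) ^+ n.
Proof.
move=> a_fpf; apply/eqP; rewrite -subr_eq0; apply/eqP.
apply: (@deriv_ode_eq0 (- (n.*2)%:R)).
  rewrite derivB !mulrBr perm_char_poly_fpf // scalerBr; congr (_ - _).
  rewrite deriv_exp derivB derivXn derivC sub0r -mul2n natrM -mul_polyC polyCN.
  rewrite polyCM !polyC_natr; case: n a a_fpf => [|n] a a_fpf.
    by rewrite mulr0n; ring.
  by rewrite -pred_Sn [in RHS]exprS; ring.
rewrite -horner_coef0 !hornerE perm_char_poly0.
by rewrite expr1n subrr.
Qed.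

(** * Coefficients of the hook generating function *)

Lemma coef_logq N k :
  (logq N)`_k =
  if (0 < k <= N)%N then ((k%:R : rat)^-1)%:P * ('X^k - 1) else 0.
Proof.
rewrite /logq coef_sum; under eq_bigr => m _ do rewrite coefCM coefXn.
case: ifP => [|k_out]; last first.
  rewrite big_nat big1 // => m /andP[m0 mN]; case: eqP => [km|]; rewrite ?mulr0 //.
  by rewrite km m0 -ltnS mN in k_out.
case/andP=> k0 kN; rewrite (bigD1_seq k) ?mem_index_iota ?iota_uniq ?k0 ?ltnS //=.
by rewrite eqxx mulr1 big1 ?addr0 // => m /negPf mk; rewrite eq_sym mk mulr0.
Qed.

Lemma coef_deriv_logq N k : (k < N)%N ->
  ((logq N)^`())`_k = 'X^(k.+1) - 1 :> {poly rat}.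
Proof.
move=> kN; rewrite coef_deriv coef_logq /= kN -mulrnAl -polyCMn.
by rewrite -[_ *+ _]mulr_natr mulVf ?pnatr_eq0 // mul1r.
Qed.

(* [(1 - x) (1 - x xi)] times the [x]-derivative of [log ((1 - x) / (1 - x xi))]
   is [xi - 1]. *)
Lemma coef_ode_logq N k : (k < N)%N ->
  ((1 - 'X) * ((1 - 'X%:P * 'X) * (logq N)^`()))`_k =
  if k == 0%N then 'X - 1 else 0.
Proof.
move=> kN; rewrite !mulrBl !mul1r !coefB !coefXM -!mulrA coefCM coefXM.
rewrite !coefB coefCM coefXM !coef_deriv_logq //; try lia.
case: k kN => [|[|k]] kN /=; rewrite ?mulr0 ?subr0 ?expr1.
- by ring.
- by ring.
- by rewrite !exprS; ring.
Qed.

(** The chain rule carries the differential equation over to powers of [logq N]. At [k = 0] the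
    truncated predecessor is harmless, because its factor [k.-1%:R] is zero. *)
Lemma coef_logqX_rec N nu k (c := fun nu k => (logq N ^+ nu)`_k) : (k < N)%N ->
  k.+1%:R * c nu.+1 k.+1 =
  (1 + 'X) * (k%:R * c nu.+1 k) - 'X * (k.-1%:R * c nu.+1 k.-1) +
  nu.+1%:R * (('X - 1) * c nu k).
Proof.
move=> kN; have coefTM: ((1 - 'X) * ((1 - 'X%:P * 'X) * (logq N)^`()) * logq N ^+ nu)`_k
    = ('X - 1) * c nu k.
  rewrite coefM big_ord_recl coef_ode_logq ?(leq_ltn_trans _ kN) //= subn0.
  rewrite big1 ?addr0 // => i _; rewrite coef_ode_logq ?mul0r //.
  exact: leq_ltn_trans kN.
pose q := logq N ^+ nu.+1.
have coefTq: ((1 - 'X) * ((1 - 'X%:P * 'X) * q^`()))`_k =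
    nu.+1%:R * (('X - 1) * c nu k).
  by rewrite -coefTM mulr_natl -coefMn /q deriv_exp -!mulrnAr !mulrA.
rewrite -coefTq !mulrBl !mul1r !coefB !coefXM -!mulrA coefCM coefXM.
rewrite !coefB coefCM coefXM !coef_deriv /c -/q -![q`__ *+ _]mulr_natl.
case: k {kN coefTM coefTq} => [|[|k]] /=; by ring.
Qed.

(* Up to sign, the Schur function of the hook with arm [l] and size [k] at
   [(1, ..., 1)], as a polynomial in the number [y] of ones. *)
Definition hook_poly k l : {poly rat} :=
  if l is l'.+1 then
    (-1) ^+ (k + l') * 'C(k.-1, l')%:R * poly_bin ('X + l'%:R) k
  else 0.

Lemma mul_bin_diag_natr (R : comNzRingType) k l :
  k%:R * 'C(k.-1, l)%:R = (k%:R - l%:R) * 'C(k, l)%:R :> R.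
Proof.
have [le_lk|lt_kl] := leqP l k.
  by rewrite -natrB // -!natrM; congr (_%:R); rewrite mul_bin_down.
rewrite [in RHS]bin_small // mulr0; case: k lt_kl => [|k] lt_kl; first by rewrite mul0r.
by rewrite bin_small ?mulr0 // (ltn_trans _ lt_kl).
Qed.

Lemma mul_bin_left_natr (R : comNzRingType) k l :
  l.+1%:R * 'C(k, l.+1)%:R = (k%:R - l%:R) * 'C(k, l)%:R :> R.
Proof.
have [le_lk|lt_kl] := leqP l k.
  by rewrite -natrB // -!natrM mul_bin_left.
by rewrite !bin_small ?mulr0 // ltnW.
Qed.

Lemma hook_poly_rec k l :
  k.+2%:R * hook_poly k.+2 l.+1 =
  k.+1%:R * (hook_poly k.+1 l.+1 + hook_poly k.+1 l) - k%:R * hook_poly k l +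
  'X * (hook_poly k.+1 l - hook_poly k.+1 l.+1).
Proof.
case: l => [|l].
  rewrite /hook_poly !addn0 !bin0 !mulr1 mulrCA poly_binS exprS.
  by ring.
rewrite /= mulrCA addnS exprS.
(* The factor [k.+1%:R] lets [E1], [E2] and [E3] reduce all the binomials to multiples of [b0]. *)
apply: (@natr_polyI k).
have E1 := poly_binS ('X + l%:R) k.
have E2 := poly_bin_absorb ('X + l%:R) k.
have E3 := poly_binS ('X + l%:R + 1) k.+1.
have E4 : k%:R * 'C(k.-1, l)%:R = (k%:R - l%:R) * 'C(k, l)%:R :> {poly rat}
  := mul_bin_diag_natr _ k l.
have E5 : l.+1%:R * 'C(k, l.+1)%:R = (k%:R - l%:R) * 'C(k, l)%:R :> {poly rat}.
  exact: mul_bin_left_natr.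
rewrite -(natr1 l) addrA.
set b0 := poly_bin ('X + l%:R) k in E1 E2 *.
set b1 := poly_bin ('X + l%:R) k.+1 in E1 *.
set b2 := poly_bin ('X + l%:R + 1) k.+1 in E2 E3 *.
set b3 := poly_bin ('X + l%:R + 1) k.+2 in E3 *.
rewrite binS natrD.
set p : {poly rat} := 'C(k, l)%:R in E4 E5 *.
set q : {poly rat} := 'C(k, l.+1)%:R in E5 *.
set r : {poly rat} := 'C(k.-1, l)%:R in E4 *.
rewrite !addSn !addnS !exprS.
set s : {poly rat} := (-1) ^+ (k + l).
transitivity (- (s * (q + p) * ('X + l%:R - k%:R) * (k.+1%:R * b2))).
  by rewrite E3 -(natr1 k); ring.
transitivity (k.+1%:R * s * (q * (k.+1%:R * b2) - p * (k.+1%:R * b1))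
    - k.+1%:R * s * b0 * (k%:R * r)
    - 'X * s * (p * (k.+1%:R * b1) + q * (k.+1%:R * b2))); last by ring.
rewrite E1 E2 E4 -(natr1 k); apply/eqP; rewrite -subr_eq0; apply/eqP.
transitivity (s * b0 * ('X + l%:R + 1) * ((k%:R - l%:R) * p - l.+1%:R * q)).
  by rewrite -(natr1 l); ring.
by rewrite E5 subrr mulr0.
Qed.

(** This extends [gf_coef] to every degree [k] in [x], for an induction on [k] at a fixed truncation
    order [N]. *)
Definition xcoef N nu k l : rat :=
  (geoq N * (logq N ^+ nu)`_k)`_l / (nu`!)%:R.

Lemma coef_natM (R : comNzRingType) m (p : {poly R}) i :
  (m%:R * p)`_i = m%:R * p`_i.
Proof. by rewrite !mulr_natl coefMn. Qed.

Lemma xcoef_rec N nu k l : (k < N)%N ->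
  k.+1%:R * xcoef N nu.+1 k.+1 l.+1 =
  k%:R * (xcoef N nu.+1 k l.+1 + xcoef N nu.+1 k l)
  - k.-1%:R * xcoef N nu.+1 k.-1 l + (xcoef N nu k l - xcoef N nu k l.+1).
Proof.
move=> kN; pose c nu k := geoq N * (logq N ^+ nu)`_k.
have: k.+1%:R * c nu.+1 k.+1 = k%:R * c nu.+1 k + 'X * (k%:R * c nu.+1 k)
    - 'X * (k.-1%:R * c nu.+1 k.-1) + nu.+1%:R * ('X * c nu k - c nu k).
  by rewrite mulrCA coef_logqX_rec // /c; ring.
move/(congr1 (fun p : {poly rat} => p`_l.+1)).
rewrite !(coefD, coefN, coef_natM, coefXM) /= => E.
have nz: nu`!%:R != 0 :> rat by rewrite pnatr_eq0 -lt0n fact_gt0.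
have nz1: nu.+1%:R != 0 :> rat by rewrite pnatr_eq0.
rewrite /xcoef -/(c _ _) mulrA E factS natrM -!/(c _ _).
move: nz nz1; move: (nu.+1%:R) (nu`!%:R) => z w nz nz1.
by field; rewrite nz nz1.
Qed.

Lemma coef_geoq N l : (geoq N)`_l = (0 < l <= N)%N%:R.
Proof.
rewrite /geoq coef_sum; under eq_bigr => m _ do rewrite coefXn.
case: (boolP (0 < l <= N)%N) => [/andP[l0 lN]|l_out]; last first.
  rewrite big_nat big1 // => m /andP[m0 mN]; case: eqP => // lm.
  by rewrite lm m0 -ltnS mN in l_out.
rewrite (bigD1_seq l) ?mem_index_iota ?iota_uniq ?l0 ?ltnS //= eqxx.
by rewrite big1 ?addr0 // => m /negPf ml; rewrite eq_sym ml.
Qed.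

Lemma xcoef_nu0 N k l : xcoef N 0 k.+1 l = 0.
Proof. by rewrite /xcoef expr0 coef1 mulr0 coef0 mul0r. Qed.

Lemma xcoef_l0 N nu k : xcoef N nu k 0 = 0.
Proof. by rewrite /xcoef (coef0M (geoq N)) coef_geoq !mul0r. Qed.

Lemma xcoef_k0 N nu l : xcoef N nu 0 l = ((nu == 0%N) && (0 < l <= N))%N%:R.
Proof.
rewrite /xcoef; case: nu => [|nu].
  by rewrite expr0 coef1 (mulr1 (geoq N)) coef_geoq divr1.
by rewrite exprS coef0M coef_logq /= mul0r mulr0 coef0 mul0r.
Qed.

Lemma xcoef1 N nu l : (0 < N)%N -> (l <= N)%N ->
  xcoef N nu 1 l = (hook_poly 1 l)`_nu.
Proof.
move=> N0; case: l => [|l] lN; first by rewrite xcoef_l0 coef0.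
have -> : hook_poly 1 l.+1 = - 'X * (l == 0%N)%:R.
  by rewrite /hook_poly poly_bin1 bin0n; case: l {lN} => [|l] /=; ring.
case: nu => [|nu]; first by rewrite xcoef_nu0 mulNr coefN coefXM oppr0.
have := xcoef_rec nu l N0; rewrite !xcoef_k0 /= !mul0r subr0 add0r mul1r => ->.
rewrite mulNr coefN coefXM /= -polyC_natr coefC lN (ltnW lN) !andbT.
by case: nu => [|nu]; case: l {lN} => [|l] //=; ring.
Qed.

Lemma xcoefE N nu k l : (k < N)%N -> (l <= N)%N ->
  xcoef N nu k.+1 l = (hook_poly k.+1 l)`_nu.
Proof.
elim/ltn_ind: k nu l => -[|k] IH nu l kN lN; first exact: xcoef1.
case: l lN => [|l] lN; first by rewrite xcoef_l0 coef0.
have nz : k.+2%:R != 0 :> rat by rewrite pnatr_eq0.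
apply: (mulfI nz); rewrite -coef_natM hook_poly_rec.
rewrite !(coefD, coefN, coef_natM, coefXM).
have IHk i : (i <= N)%N -> forall nu, (hook_poly k.+1 i)`_nu = xcoef N nu k.+1 i.
  by move=> iN nu'; rewrite IH // ltnW.
(* At [k = 0] the two coefficients differ in general; the factor [k%:R] removes that case. *)
have IHk1 i : (i <= N)%N -> forall nu,
    k%:R * (hook_poly k i)`_nu = k%:R * xcoef N nu k i.
  move=> iN nu'; case: k {IHk nz} IH kN => [|k] IH kN; first by rewrite !mul0r.
  by rewrite IH // -ltnS ltnW // ltnW.
rewrite !IHk1 ?IHk ?(ltnW lN) //; case: nu => [|nu] /=.
  rewrite !xcoef_nu0; case: k {IH IHk IHk1 nz} kN => [|k] kN.
    by ring.
  by rewrite !xcoef_nu0; ring.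
by rewrite xcoef_rec // ?IHk ?(ltnW lN) //=; ring.
Qed.

Lemma gf_coefE N nu l : (0 < N)%N -> (l <= N)%N ->
  gf_coef N nu l = (hook_poly N l)`_nu.
Proof. by case: N => // N _ lN; apply: xcoefE. Qed.

(** * Distribution of the number of cycles *)

Lemma full_cyclesE n : full_cycles n.+1 = [set s | #|porbits s| == 1%N].
Proof.
apply/setP => s; rewrite !inE; apply/forallP/cards1P => [full_s|[c def_c] i].
  have orbT i: porbit s i = [set: 'I_n.+1].
    by apply/eqP; rewrite eqEcard subsetT cardsT card_ord (eqP (full_s i)) leqnn.
  exists [set: 'I_n.+1]; apply/setP => c; rewrite inE.
  apply/imsetP/eqP => [[i _ ->] //|->]; by exists 0; rewrite ?orbT.
have orbc j: porbit s j = c by apply/set1P; rewrite -def_c imset_f.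
rewrite orbc; suff ->: c = [set: 'I_n.+1] by rewrite cardsT card_ord.
by apply/setP => j; rewrite inE -(orbc j) porbit_id.
Qed.

Lemma fpf_involutions_neq0 n : (0 < #|fpf_involutions n.*2|)%N.
Proof.
(* The reversal of an even number of points has no fixed point. *)
apply/card_gt0P; exists (perm (@rev_ord_inj n.*2)).
rewrite inE; apply/forallP => i; rewrite !permE rev_ordK eqxx /=.
apply/eqP => /(congr1 val) /=; have := ltn_ord i; lia.
Qed.

(** [cycle_enum] takes the same value at all fixed-point-free involutions, so averaging over them
    has no effect, and the number of full cycles cancels the factorial. *)
Lemma prob_ncyclesE n nu :
  prob_ncycles n.+1.*2 nu = (shift_coef n.+1.*2.+1 ((1 - 'X^2) ^+ n.+1))`_nu.
Proof.
set N := n.+1.*2; rewrite /prob_ncycles.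
have cardP : #|[set p : 'S_N * 'S_N | [&& p.1 \in fpf_involutions N,
      p.2 \in full_cycles N & ncycles (p.1 * p.2)%g == nu]]|%:R =
    \sum_(a in fpf_involutions N) (cycle_enum a)`_nu.
  rewrite -sum1_card natr_sum.
  rewrite (eq_bigl (fun p : 'S_N * 'S_N => (p.1 \in fpf_involutions N) &&
    ((p.2 \in full_cycles N) && (ncycles (p.1 * p.2)%g == nu)))); last first.
    by move=> p; rewrite inE.
  rewrite -(pair_big_dep (fun a => a \in fpf_involutions N)
    (fun a b => (b \in full_cycles N) && (ncycles (a * b)%g == nu))
    (fun _ _ => 1)) /=.
  apply: eq_bigr => a _; rewrite /cycle_enum coef_sum big_mkcondr /=.
  rewrite (eq_bigl (fun b : 'S_N => #|porbits b| == 1%N)); last first.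
    by move=> b; rewrite full_cyclesE inE.
  by apply: eq_bigr => b _; rewrite coefXn /ncycles eq_sym; case: eqP.
rewrite cardP (eq_bigr (fun => N.-1`!%:R * (shift_coef N.+1 ((1 - 'X^2) ^+ n.+1))`_nu)).
  rewrite sumr_const full_cyclesE card_single_porbit natrM -[_ *+ _]mulr_natl.
  rewrite mulrA mulrAC divff ?mul1r // mulf_neq0 // pnatr_eq0 -lt0n ?fact_gt0 //.
  exact: fpf_involutions_neq0.
move=> a a_fpf; rewrite cycle_enumE coef_natM.
by congr (_ * (shift_coef _ _)`_nu); apply: (@perm_char_poly_fpfE n.+1).
Qed.

Lemma big_nat_double (V : nmodType) m (f : nat -> V) :
  \sum_(1 <= l < m.*2.+1) f l = \sum_(j < m) (f j.*2.+1 + f j.*2.+2).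
Proof.
elim: m => [|m IHm]; first by rewrite big_geq // big_ord0.
by rewrite doubleS big_nat_recr // big_nat_recr //= IHm big_ord_recr /= addrA.
Qed.

(** One factor is split as [(1 - 'X) * (1 + 'X)]: the first part lowers the index, the second gives
    two neighbouring binomials for each [j], those of [hook_poly] at [j.*2.+1] and [j.*2.+2]. *)
Lemma shift_coef_fpf m :
  shift_coef m.+1.*2.+1 ((1 - 'X^2) ^+ m.+1) =
  \sum_(j < m.+1) ((-1) ^+ (m - j) * 'C(m, j)%:R) *:
     (poly_bin ('X + j.*2%:R) m.+1.*2 + poly_bin ('X + j.*2.+1%:R) m.+1.*2).
Proof.
have ->: (1 - 'X^2) ^+ m.+1 = (1 - 'X) * ((1 + 'X) * (1 - 'X^2) ^+ m) :> {poly rat}.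
  by rewrite exprS; ring.
rewrite shift_coefM1X exprDn mulr_sumr linear_sum /= (reindex_inj rev_ord_inj) /=.
apply: eq_bigr => j _; rewrite subSS; have le_jm: (j <= m)%N by rewrite -ltnS.
set i := (m - j)%N; rewrite bin_sub // expr1n mul1r.
have ->: (1 + 'X) * ((- 'X^2) ^+ i *+ 'C(m, j)) =
    ((-1) ^+ i * 'C(m, j)%:R) *: ('X^(i.*2.+1) + 'X^(i.*2)) :> {poly rat}.
  rewrite (exprNn 'X^2) -exprM mul2n -mul_polyC polyCM polyC_natr rmorphXn rmorphN1 /=.
  by rewrite exprS -mulr_natr; ring.
rewrite linearZ linearD /= !shift_coefXn; congr (_ *: (poly_bin _ _ + poly_bin _ _)).
  have ->: m.+1.*2 = (j.*2 + i.*2.+1 + 1)%N by rewrite /i; lia.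
  by rewrite !natrD; ring.
have ->: m.+1.*2 = (j.*2.+1 + i.*2 + 1)%N by rewrite /i; lia.
by rewrite !natrD; ring.
Qed.

Lemma signr_double (R : pzRingType) k : (-1) ^+ k.*2 = 1 :> R.
Proof. by rewrite -signr_odd odd_double. Qed.

Unset Implicit Arguments.

Theorem theorem2p1 (n nu : nat) :
  (1 <= n)%N -> (1 <= nu <= n.*2)%N ->
  prob_ncycles n.*2 nu =
  \sum_(1 <= l < n.*2.+1)
     (-1) ^+ (n.*2 + 1 - l)%N * Fcoef n.*2 l * gf_coef n.*2 nu l.
Proof.
case: n => // m _ _; rewrite prob_ncyclesE shift_coef_fpf coef_sum big_nat_double.
apply: eq_bigr => j _; have le_jm: (j <= m)%N by rewrite -ltnS.
rewrite !gf_coefE; try lia.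
rewrite /hook_poly /Fcoef /= odd_double /= coefZ coefD.
have ->: (m.+1.*2 + 1 - j.*2.+1 = (m.+1 - j).*2)%N by lia.
have ->: (m.+1.*2 + 1 - j.*2.+2 = (m - j).*2.+1)%N by lia.
have ->: (((m.+1 - j).*2 + 2)./2 = (m - j).+2)%N by lia.
have ->: (((m - j).*2.+1 - 1)./2 = m - j)%N by lia.
have ->: ((m.+1.*2 - 2)./2 = m)%N by lia.
have ->: ((j.*2.+1 - 1)./2 = j)%N by lia.
have ->: (m.+1.*2 + j.*2 = (m.+1 + j).*2)%N by lia.
have ->: (m.+1.*2 + j.*2.+1 = (m.+1 + j).*2.+1)%N by lia.
have ->: (m.+1.*2 - 1 = m.*2.+1)%N by lia.
have ->: (j.*2.+1 - 1 = j.*2)%N by lia.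
have ->: (j.*2.+2 - 1 = j.*2.+1)%N by lia.
(* For odd [l] the outer sign and the hook sign are both positive, for even [l] both negative;
   either way only the sign of [Fcoef] survives. *)
rewrite !exprS !signr_double !mulr1 mul1r.
(* The binomial in [hook_poly] cancels the denominator of [Fcoef], which has to be nonzero. *)
have nzC i : (i <= m.*2.+1)%N -> 'C(m.*2.+1, i)%:R != 0 :> rat.
  by move=> le_i; rewrite pnatr_eq0 -lt0n bin_gt0.
rewrite !mulN1r !opprK !mul1r !mulNr coefN !mul1r !coef_natM.
by field; rewrite !nzC //; lia.
Qed.
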